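(* Let $n\ge1$. The poset $\mathrm{bic}(\widetilde{C}_n)$ of biclosed sets of positive roots of $\widetilde{C}_n$, ordered by containment, is a lattice.
   Context: Let $N=2n+1$ and let $V$ be the real vector space spanned by $\widetilde{e}_i$, $i\in\mathbb{Z}$, modulo $\widetilde{e}_{i+N}=\widetilde{e}_i+\widetilde{e}_N$ and $\widetilde{e}_{-i}=-\widetilde{e}_i$. The root system of $\widetilde{C}_n$ (the affine Weyl group realized as permutations $f$ of $\mathbb{Z}$ with $f(x+N)=f(x)+N$, $f(-x)=-f(x)$) is $\{\widetilde{e}_j-\widetilde{e}_i: i,j\not\equiv0\bmod N,\ i\not\equiv j\bmod N\}$, with positive roots those with $i<j$. A set $B$ of positive roots is biclosed if for positive roots $\alpha,\beta,\gamma$ with $\gamma\in\mathbb{R}_{>0}\alpha+\mathbb{R}_{>0}\beta$: $\alpha,\beta\in B\Rightarrow\gamma\in B$ and $\alpha,\beta\notin B\Rightarrow\gamma\notin B$. *)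

(* Defs.v *)
From HB Require Import structures.
From mathcomp Require Import all_boot all_order all_algebra.
From mathcomp Require Import all_classical reals.
From mathcomp Require Import zify.

Set Implicit Arguments.
Unset Strict Implicit.
Unset Printing Implicit Defensive.

Import Order.TTheory GRing.Theory Num.Theory.
Local Open Scope classical_set_scope.
Local Open Scope ring_scope.

Definition perC (n : nat) : int := (n.*2.+1)%:Z.

(* The space spanned by the e_i modulo e_(i+N) = e_i + e_N, e_(-i) = - e_i, in
   coordinates: coordinate 0 is along e_N and coordinate k, 1 <= k <= n, is
   along e_k; [etilde_universal] below shows that it is the presented space. *)
Definition spaceC (R : realType) (n : nat) := 'rV[R]_n.+1.

(* If i = q N + r with 0 <= r < N, the relations force e_i = q e_N + e_r, where
   e_0 = 0 and e_r = e_N - e_(N - r) for n < r < N. *)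
Definition etilde (R : realType) (n : nat) (i : int) : spaceC R n :=
  let N := perC n in
  let q := (i %/ N)%Z in
  let r := (i %% N)%Z in
  \row_(k < n.+1)
    if k == ord0 then q%:~R + (n%:Z < r)%R%:R
    else (r == k%:Z)%:R - (r == N - k%:Z)%:R.

Definition posrootC (R : realType) (n : nat) : set (spaceC R n) :=
  [set v | exists i j : int,
     [/\ (i != 0 %[mod perC n])%Z, (j != 0 %[mod perC n])%Z,
         (i != j %[mod perC n])%Z, i < j & v = etilde R n j - etilde R n i]].
Arguments posrootC : clear implicits.

Definition in_open_cone (R : realType) (n : nat) (a b g : spaceC R n) : Prop :=
  exists s t : R, [/\ 0 < s, 0 < t & g = s *: a + t *: b].

Definition biclosed (R : realType) (n : nat) (B : set (spaceC R n)) : Prop :=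
  B `<=` posrootC R n /\
  forall a b g, posrootC R n a -> posrootC R n b -> posrootC R n g ->
    in_open_cone a b g ->
    (B a -> B b -> B g) /\ (~ B a -> ~ B b -> ~ B g).

Definition bic (R : realType) (n : nat) : Type :=
  {B : set (spaceC R n) | `[< biclosed B >]}.

HB.instance Definition _ (R : realType) (n : nat) := SubType.on (bic R n).
HB.instance Definition _ (R : realType) (n : nat) := Choice.on (bic R n).
HB.instance Definition _ (R : realType) (n : nat) :=
  [SubChoice_isSubPOrder of bic R n by <: with set_display].

Lemma bic_leE (R : realType) (n : nat) (A B : bic R n) :
  ((A <= B)%O : Prop) = (val A `<=` val B).
Proof. by rewrite -subsetEset. Qed.

Definition is_lattice (d : Order.disp_t) (T : porderType d) : Prop :=
  forall x y : T,
    supremums [set x; y] !=set0 /\ infimums [set x; y] !=set0.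

Section Presentation.
Variables (R : realType) (n : nat).
Local Notation N := (perC n).
Local Notation e := (etilde R n).

Lemma etilde0 : e 0 = 0.
Proof.
apply/rowP => k; rewrite !mxE div0z mod0z.
case: ifPn => [_|k0]; first by rewrite add0r (_ : _ < _ = false) //; lia.
have k_gt0 : (0 < k)%N by rewrite lt0n.
have := ltn_ord k => kn.
rewrite (_ : (0 == k%:Z) = false); last by lia.
by rewrite (_ : (0 == N - k%:Z) = false) ?subr0 // /perC; lia.
Qed.

Lemma etildeN_delta : e N = delta_mx 0 ord0.
Proof.
apply/rowP => k; rewrite !mxE divzz modzz eqxx /=.
case: ifPn => [_|k0].
  by rewrite addr0.
have k_gt0 : (0 < k)%N by rewrite lt0n.
have := ltn_ord k => kn.
rewrite (_ : (0 == k%:Z) = false); last by lia.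
by rewrite (_ : (0 == N - k%:Z) = false) ?subr0 // /perC; lia.
Qed.

Lemma etilde_delta (k : 'I_n.+1) : k != ord0 -> e k%:Z = delta_mx 0 k.
Proof.
move=> k0; have k_gt0 : (0 < k)%N by rewrite lt0n.
have := ltn_ord k => kn.
apply/rowP => l; have := ltn_ord l => ln; rewrite !mxE eqxx /=.
rewrite divz_small; last by rewrite /perC; lia.
rewrite modz_small; last by rewrite /perC; lia.
case: ifPn => [/eqP ->|l0].
  rewrite (_ : n%:Z < k%:Z = false) ?addr0; last by lia.
  by rewrite eq_sym (negbTE k0).
rewrite (_ : (k%:Z == N - l%:Z) = false) ?subr0; last by rewrite /perC; lia.
by rewrite eqz_nat eq_sym.
Qed.

Lemma etilde_shift (i : int) : e (i + N) = e i + e N.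
Proof.
have N0 : N != 0 by [].
rewrite etildeN_delta; apply/rowP => k; rewrite !mxE.
rewrite modzDr divzDr ?dvdzz // divzz N0 /=.
case: ifPn => [k0|k0]; last by rewrite addr0.
by rewrite rmorphD /= addrAC.
Qed.

Lemma etilde_opp (i : int) : e (- i) = - e i.
Proof.
have N0 : N != 0 by [].
have r0 := modz_ge0 i N0.
have rN : (i %% N)%Z < N by rewrite -[ltRHS]gtr0_norm // ltz_mod.
have Di := divz_eq i N.
have [r_eq0|r_neq0] := eqVneq (i %% N)%Z 0.
  rewrite r_eq0 addr0 in Di; rewrite {1}Di -mulNr.
  apply/rowP => k; rewrite !mxE r_eq0 mulzK // modzMl.
  have := ltn_ord k => kn; case: ifPn => [_|k0].
    by rewrite (_ : n%:Z < 0 = false) ?addr0 ?rmorphN //; lia.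
  have k_gt0 : (0 < k)%N by rewrite lt0n.
  rewrite (_ : (0 == k%:Z) = false); last by lia.
  by rewrite (_ : (0 == N - k%:Z) = false) ?subr0 ?oppr0 // /perC; lia.
have Dni : - i = (- (i %/ N)%Z - 1) * N + (N - (i %% N)%Z).
  by rewrite {1}Di mulrBl mul1r mulNr opprD addrA addrNK.
have sm : 0 <= N - (i %% N)%Z < `|N|%N by apply/andP; split; lia.
have Dq : ((- i) %/ N)%Z = - (i %/ N)%Z - 1.
  by rewrite Dni divzMDl // [X in _ + X]divz_small // addr0.
have Dr : ((- i) %% N)%Z = N - (i %% N)%Z.
  by rewrite Dni modzMDl modz_small.
apply/rowP => k; rewrite !mxE Dq Dr; move: r0 rN r_neq0.
move: (i %/ N)%Z (i %% N)%Z => q r r0 rN rn0.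
have := ltn_ord k => kn; case: ifPn => [_|k0].
  rewrite rmorphB rmorphN /= opprD -addrA; congr (_ + _).
  have -> : (n%:Z < N - r) = ~~ (n%:Z < r) by rewrite /perC in rN *; lia.
  by case: (n%:Z < r); rewrite ?addr0 ?oppr0 // addNr.
rewrite opprB; congr (_%:R - _%:R); lia.
Qed.

Lemma etilde_universal (W : lmodType R) (f : int -> W) :
    (forall i, f (i + N) = f i + f N) -> (forall i, f (- i) = - f i) ->
  exists L : {linear spaceC R n -> W},
    (forall i, L (e i) = f i) /\
    forall L' : {linear spaceC R n -> W}, (forall i, L' (e i) = f i) -> L' =1 L.
Proof.
move=> fS fN.
pose g (k : 'I_n.+1) : int := if k == ord0 then N else k%:Z.
have eg k : e (g k) = delta_mx 0 k.
  rewrite /g; case: ifPn => [/eqP ->|]; first exact: etildeN_delta.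
  exact: etilde_delta.
pose l (v : spaceC R n) : W := \sum_k v 0 k *: f (g k).
have lin_l : linear l.
  move=> a u v; rewrite /l scaler_sumr -big_split /=; apply: eq_bigr => k _.
  by rewrite !mxE scalerDl scalerA.
pose L : {linear spaceC R n -> W} :=
  HB.pack l (GRing.isLinear.Build R (spaceC R n) W *:%R l lin_l).
have Ldelta k : L (delta_mx 0 k) = f (g k).
  rewrite /= /l (bigD1 k) //= mxE !eqxx scale1r big1 ?addr0 // => j jk.
  by rewrite mxE (negbTE jk) andbF scale0r.
have f0 : f 0 = 0.
  have /eqP := fN 0; rewrite oppr0 -subr_eq0 opprK -mulr2n -scaler_nat.
  by rewrite scaler_eq0 pnatr_eq0 /= => /eqP.
have shift (q : nat) (h : int -> W) : (forall i, h (i + N) = h i + h N) ->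
    forall i, h (i + N *+ q) = h i + h N *+ q.
  move=> hS; elim: q => [|q IH] i; first by rewrite !mulr0n !addr0.
  by rewrite !mulrSr !addrA hS IH.
have LeS i : L (e (i + N)) = L (e i) + L (e N) by rewrite etilde_shift linearD.
have LeN i : L (e (- i)) = - L (e i) by rewrite etilde_opp linearN.
have Lf_small (k : nat) : (k <= n)%N -> L (e k%:Z) = f k%:Z.
  case: k => [|k] kn; first by rewrite etilde0 linear0 f0.
  have kn' : (k.+1 < n.+1)%N by [].
  have := Ldelta (Ordinal kn'); rewrite -eg.
  by rewrite /g (_ : (_ == ord0) = false).
have LfN : L (e N) = f N.
  by have := Ldelta ord0; rewrite -eg /g eqxx.
have Lf_mod (r : nat) : (r < n.*2.+1)%N -> L (e r%:Z) = f r%:Z.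
  move=> rN; have [/Lf_small //|nr] := leqP r n.
  have -> : r%:Z = - (n.*2.+1 - r)%N%:Z + N by rewrite /perC; lia.
  by rewrite fS LeS LfN LeN fN Lf_small //; lia.
have Lf_nat (m : nat) : L (e m%:Z) = f m%:Z.
  have -> : m%:Z = (m %% n.*2.+1)%N%:Z + N *+ (m %/ n.*2.+1)%N.
    rewrite {1}(divn_eq m n.*2.+1) addnC PoszD PoszM /perC.
    by rewrite -mulr_natl natz.
  by rewrite (shift _ f fS) (shift _ (fun i => L (e i)) LeS) LfN Lf_mod ?ltn_mod.
exists L; split=> [i|L' HL' v].
  have [m [->|->]] : exists m : nat, i = m%:Z \/ i = - m%:Z.
    by exists `|i|%N; lia.
  - exact: Lf_nat.
  - by rewrite LeN fN Lf_nat.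
rewrite [v]row_sum_delta !linear_sum; apply: eq_bigr => k _.
by rewrite !linearZZ Ldelta -eg HL'.
Qed.

End Presentation.

(* Main.v *)
Require Import Defs.
From HB Require Import structures.
From mathcomp Require Import all_boot all_order all_algebra.
From mathcomp Require Import all_classical reals.
From mathcomp Require Import zify ring lra.

(* Every root is e_p + e_q with p, q and p + q nonzero modulo N, and it is
   positive when p + q > 0.  A biclosed set is thus a symmetric, translation
   invariant relation on such pairs.  Allowing also the pairs with N | p + q
   ("imaginary" ones), biclosedness becomes closure under composition of
   intervals, (p, q), (-q, r) |-> (p, r), for the relation and its complement,
   as for the inversion set of a total order on the integers outside NZ.
   A biclosed set B determines the imaginary pairs (p, q) that are sums of two
   elements of B, and adding exactly those gives such a relation, monotonically
   in B.  Conversely the real pairs of such a relation form a biclosed set, by a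
   case analysis of three coplanar roots.  So bic is a retract, through monotone
   maps, of the poset of these relations, where the join of two elements is the
   transitive closure of their union.  Meets come from joins by complementation. *)

Set Implicit Arguments.
Unset Strict Implicit.
Unset Printing Implicit Defensive.

Import Order.TTheory GRing.Theory Num.Theory.
Local Open Scope classical_set_scope.
Local Open Scope ring_scope.

(** * Translation invariant inversion sets *)

(* The pair (p, q), with p + q > 0, stands for e_p + e_q, or for the interval
   from -p to q of the integers. *)
Definition transitive_pairs (N : int) (T : int -> int -> Prop) : Prop :=
  forall p q r : int, ~~ (N %| p)%Z -> ~~ (N %| q)%Z -> ~~ (N %| r)%Z ->
    0 < p + q -> 0 < r - q -> T p q -> T (- q) r -> T p r.

(** Moving a multiple of N from one index to the other changes neither the root e_p + e_q nor, up to
    translation, the interval from -p to q. *)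
Definition shift_invariant (N : int) (T : int -> int -> Prop) : Prop :=
  forall p q p' q' : int, (N %| p' - p)%Z -> p' + q' = p + q -> T p q -> T p' q'.

Record inversion_set (N : int) (T : int -> int -> Prop) : Prop := InversionSet {
  inv_sym : forall p q, T p q -> T q p;
  inv_shift : shift_invariant N T;
  inv_trans : transitive_pairs N T;
  inv_cotrans : transitive_pairs N (fun p q => ~ T p q) }.

Lemma dvdzE (d m : int) : reflect (exists k : int, m = k * d) (d %| m)%Z.
Proof. exact: dvdzP. Qed.

Lemma dvdz_eq0 (d z : int) : z = 0 -> (d %| z)%Z.
Proof. by move=> ->; rewrite dvdz0. Qed.

Lemma dvdz_subr (d x z : int) : (d %| x)%Z -> (d %| z - x)%Z -> (d %| z)%Z.
Proof. by move=> dx; rewrite rpredBr. Qed.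

Lemma dvdz_addr (d x z : int) : (d %| x)%Z -> (d %| z + x)%Z -> (d %| z)%Z.
Proof. by move=> dx; rewrite rpredDr. Qed.

Ltac keep_int_eqs :=
  repeat match goal with H : ?P |- _ =>
    lazymatch type of P with
    | Prop => lazymatch P with
              | @eq ?A _ _ => tryif unify A int then fail else clear H
              | _ => clear H
              end
    end
  end.

(* Searches for an integer combination, with coefficients 1 and -1 and at most
   [n] terms, of the divisibility hypotheses. *)
Ltac dvd_search n :=
  match n with
  | O => apply: dvdz_eq0; keep_int_eqs; lia
  | S ?m => match goal with
    | H : is_true (_ %| ?x)%Z |- _ =>
        first [ apply: (dvdz_subr H); clear H; dvd_search m
              | apply: (dvdz_addr H); clear H; dvd_search m ]
    end
  end.

Ltac dvd :=
  match goal with |- is_true (?d %| _)%Z => idtac end;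
  first [dvd_search 0%N | dvd_search 1%N | dvd_search 2%N
        | dvd_search 3%N | dvd_search 4%N].

(* [lia] gets lost in the Euclidean divisions hidden in divisibilities. *)
Ltac slia := repeat match goal with
  | H : is_true (_ %| _)%Z |- _ => clear H
  | H : is_true (~~ (_ %| _)%Z) |- _ => clear H
  end; lia.

Ltac arith :=
  lazymatch goal with |- is_true (_ %| _)%Z => dvd | _ => first [slia | lra] end.

(* Proves a non-divisibility, or [False], from the non-divisibility [H]. *)
Ltac nz H := try (apply/negP => ?); apply: (negP H); dvd.

Lemma inversion_setC (N : int) (T : int -> int -> Prop) :
  inversion_set N T -> inversion_set N (fun p q => ~ T p q).
Proof.
case=> Ts Th Tt Tc; split=> //.
- by move=> p q nT /Ts.
- move=> p q p' q' d e nT /Th; apply: contra_not nT; apply; last by rewrite e.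
  by dvd.
- move=> p q r np nq nr pq qr /contrapT T1 /contrapT T2 nT; apply: nT.
  exact: Tt T1 T2.
Qed.

Section Pairs.
Variables (N : int).
Hypothesis N_gt0 : 0 < N.

(** The interval from -p to (j + 1)N - p is a chain of j + 1 translates of the one from -p to N -
    p. *)
Lemma imaginary_up (T : int -> int -> Prop) (p : int) (j : nat) :
  shift_invariant N T -> transitive_pairs N T -> ~~ (N %| p)%Z ->
  T p (N - p) -> T p (N *+ j.+1 - p).
Proof.
move=> Th Tt np T1; elim: j => [|j IH]; first by rewrite mulr1n.
have dj : (N %| N *+ j.+1)%Z by rewrite -mulr_natr dvdz_mulr.
have pj : 0 < N *+ j.+1 by rewrite pmulrn_lgt0.
rewrite mulrSr; apply: (Tt p (N *+ j.+1 - p)) => //; try lia.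
- by nz np.
- by have dN := dvdzz N; nz np.
- by apply: Th T1; [dvd|lia].
Qed.

(** By [imaginary_up] for [T] and for its complement, every positive imaginary pair at p lies on the
    same side as the one of length N. *)
Lemma imaginary_indep (T : int -> int -> Prop) (p m m' : int) :
  inversion_set N T -> ~~ (N %| p)%Z ->
  (N %| m)%Z -> (N %| m')%Z -> 0 < m -> 0 < m' -> T p (m - p) -> T p (m' - p).
Proof.
move=> TI np.
have mulE x : (N %| x)%Z -> 0 < x -> exists j, x = N *+ j.+1.
  case/dvdzE => k -> k0; have k1 : 0 < k by nia.
  by exists `|k - 1|%N; rewrite -mulr_natr mulrC; congr (_ * _); lia.
move=> /mulE h /mulE h' /h[j ->] /h'[j' ->] Tm.
apply: imaginary_up => //; try exact: inv_shift TI; try exact: inv_trans TI.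
apply: contrapT => nT.
have TIC := inversion_setC TI.
exact: (imaginary_up j (inv_shift TIC) (inv_trans TIC) np nT Tm).
Qed.

End Pairs.

(** * Cones spanned by two pairs, by relative position *)

Section Cones.
Variables (N : int) (T : int -> int -> Prop).
Hypotheses (N_gt0 : 0 < N) (TI : inversion_set N T).

(** If the interval from q to q + m is in [T], compose with it. Otherwise, by [imaginary_indep],
    neither is the one from q + m to q + M, and if (p, q + m) were outside [T], cotransitivity would
    exclude (p, q + M). *)
Lemma between_pair (p q m M : int) :
  ~~ (N %| p)%Z -> ~~ (N %| q)%Z -> (N %| m)%Z -> (N %| M)%Z ->
  0 < p + q -> 0 <= m <= M -> T p q -> T p (q + M) -> T p (q + m).
Proof.
move=> np nq dm dM pq /andP[m0 mM] T1 T2.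
have [->|nmM] := eqVneq m M; first by [].
have [m_eq0|nm0] := eqVneq m 0; first by rewrite m_eq0 addr0.
have dMm : (N %| M - m)%Z by dvd.
have [Tq|nTq] := pselect (T (- q) (q + m)).
  by apply: (inv_trans TI) T1 Tq => //; [nz nq|slia].
apply: contrapT => nT.
suff nTM : ~ T (- (q + m)) (q + M).
  by apply: (inv_cotrans TI) nT nTM T2 => //; try slia; nz nq.
move=> TM; apply: nTq.
have := @imaginary_indep N N_gt0 T (- q) (M - m) m TI.
rewrite opprK [_ + q]addrC [m + q]addrC; apply; try slia; try by [].
  by nz nq.
by apply: (inv_shift TI) TM; [dvd|slia].
Qed.

Variable R : realFieldType.
Implicit Types s t : R.

(** The three roots agree modulo e_N, so only their heights under e_i |-> i matter, and the convex
    combination puts g + h between p + q and u + v. *)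
Lemma cone_parallel s t (p q u v g h : int) :
  ~~ (N %| p)%Z -> ~~ (N %| q)%Z ->
  (N %| u - p)%Z -> (N %| v - q)%Z -> (N %| g - p)%Z -> (N %| h - q)%Z ->
  0 < p + q -> 0 < u + v -> 0 < s -> 0 < t -> s + t = 1 ->
  (g + h)%:~R = s * (p + q)%:~R + t * (u + v)%:~R ->
  T p q -> T u v -> T g h.
Proof.
wlog le_pq_uv : s t p q u v / p + q <= u + v.
  move=> IH np nq up vq gp hq pq uv s0 t0 st E T1 T2.
  have [|lt] := leP (p + q) (u + v).
    by move=> le; apply: (IH s t p q u v).
  apply: (IH t s u v p q) => //; try (by arith).
  - by nz np.
  - by nz nq.
move=> np nq up vq gp hq pq uv s0 t0 st E T1 T2.
have s1 : s = 1 - t by lra.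
have le : (p + q)%:~R <= (u + v)%:~R :> R by rewrite ler_int.
have h1 : p + q <= g + h by rewrite -(ler_int R) E; nra.
have h2 : g + h <= u + v by rewrite -(ler_int R) E; nra.
suff : T p (q + (g + h - (p + q))).
  by apply: (inv_shift TI); [dvd|slia].
apply: (@between_pair p q _ (u + v - (p + q))) => //; try (by arith).
by apply: (inv_shift TI) T2; [dvd|slia].
Qed.

(** Modulo e_N the given roots are 2e_p and 2e_u, and e_g + e_h is their half sum. If (p, w), a
    translate of (g, h), is not in [T], cotransitivity puts the interval from w to q in [T]. Its
    reversal, from -q to -w, followed by a translate of (u, v), gives (q, u + v - w), which is again
    a translate of (p, w). *)
Lemma cone_half_lt (p q u v g h : int) :
  ~~ (N %| p)%Z -> ~~ (N %| u)%Z ->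
  (N %| q - p)%Z -> (N %| v - u)%Z -> (N %| g - p)%Z -> (N %| h - u)%Z ->
  0 < p + q -> 0 < u + v -> (g + h) + (g + h) = (p + q) + (u + v) ->
  g + h < p + q -> T p q -> T u v -> T g h.
Proof.
move=> np nu qp vu gp hu pq uv E lt T1 T2.
have np' : ~~ (N %| q)%Z by nz np.
have [w wE] : exists w : int, w = g + h - p by exists (g + h - p).
have wu : (N %| w - u)%Z by dvd.
have pw : 0 < p + w by slia.
have qw : 0 < q - w by slia.
have nw : ~~ (N %| w)%Z by nz nu.
apply: contrapT => nTgh.
have nT : ~ T p w.
  by move=> Tw; apply: nTgh; apply: (inv_shift TI) Tw; [dvd|slia].
have Tq : T (- w) q.
  apply: contrapT => nTq.
  exact: (inv_cotrans TI np nw np' pw qw nT nTq T1).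
have T3 : T (- - w) (u + v - w).
  by rewrite opprK; apply: (inv_shift TI) T2; [dvd|slia].
apply: nT.
have : T q (u + v - w).
  apply: (inv_trans TI) (inv_sym TI Tq) T3 => //.
  - by nz nu.
  - by nz nu.
  - by slia.
by apply: (inv_shift TI); [dvd|slia].
Qed.

Lemma cone_half (p q u v g h : int) :
  ~~ (N %| p)%Z -> ~~ (N %| u)%Z -> ~~ (N %| p - u)%Z ->
  (N %| q - p)%Z -> (N %| v - u)%Z -> (N %| g - p)%Z -> (N %| h - u)%Z ->
  0 < p + q -> 0 < u + v -> (g + h) + (g + h) = (p + q) + (u + v) ->
  T p q -> T u v -> T g h.
Proof.
move=> np nu npu qp vu gp hu pq uv E T1 T2.
have [lt|gt|eq] := ltgtP (g + h) (p + q).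
- exact: (cone_half_lt np nu qp vu gp hu).
- apply: (inv_sym TI).
  by apply: (@cone_half_lt u v p q h g) => //; try slia.
- by case: (negP npu); dvd.
Qed.

(** The roots are opposite modulo e_N and compose to the imaginary pair (q, v). By [imaginary_indep]
    its length can be changed to g + h - (p + q); appending a translate of the result to (p, q)
    gives (g, h). *)
Lemma cone_antiparallel s t (p q v g h : int) :
  ~~ (N %| p)%Z -> ~~ (N %| q)%Z -> (N %| v + q)%Z ->
  (N %| g - p)%Z -> (N %| h - q)%Z ->
  0 < p + q -> 0 < v - p -> 0 < t -> s - t = 1 ->
  (g + h)%:~R = s * (p + q)%:~R + t * (v - p)%:~R ->
  T p q -> T (- p) v -> T g h.
Proof.
move=> np nq vq gp hq pq vp t0 st E T1 T2.
have qv0 : 0 < q + v by slia.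
have E' : (g + h)%:~R = (p + q)%:~R + t * (q + v)%:~R :> R.
  have s1 : s = 1 + t by lra.
  by rewrite E s1 !rmorphD rmorphN /=; ring.
have m0 : 0 < g + h - (p + q).
  have : (p + q)%:~R < (g + h)%:~R :> R.
    by rewrite E' ltrDl mulr_gt0 // ltr0z.
  by rewrite ltr_int; slia.
have Tv : T q (q + v - q).
  rewrite (_ : q + v - q = v); last slia.
  by apply: (inv_trans TI) (inv_sym TI T1) T2 => //; [nz nq|slia].
have Tm : T q (g + h - (p + q) - q).
  by apply: (imaginary_indep N_gt0 TI nq _ _ qv0 m0 Tv); dvd.
have {}Tm : T (- q) (g + h - p).
  by apply: (inv_shift TI) (inv_sym TI Tm); [dvd|slia].
have : T p (g + h - p).
  by apply: (inv_trans TI) T1 Tm => //; [nz nq|slia].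
by apply: (inv_shift TI); [dvd|slia].
Qed.

End Cones.

(** * Coplanar triples of roots *)

(* The coordinate along [e_x] of the image of [e_y] modulo [e_N]. *)
Definition coordC (R : pzRingType) (N x y : int) : R :=
  (N %| y - x)%Z%:R - (N %| y + x)%Z%:R.

Section Coordinates.
Variables (N : int) (R : realFieldType).
Hypothesis N_odd : exists k : int, N = k + k + 1.
Local Notation cc := (@coordC R N).

Lemma not_eq_opp (x y : int) :
  ~~ (N %| x)%Z -> (N %| y - x)%Z -> ~~ (N %| y + x)%Z.
Proof.
move=> nx /dvdzE[a Ea]; apply/negP => /dvdzE[b Eb]; case/negP: nx.
(* N = 2k + 1 and 2x = (b - a)N give x = Nx - k(2x). *)
have [k Ek] := N_odd; apply/dvdzE; exists (x - k * (b - a)).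
have h : (b - a) * N = x + x by rewrite mulrBl -Ea -Eb; ring.
by rewrite mulrBl -mulrA h {1}Ek; ring.
Qed.

Lemma coord_eq (x y : int) : ~~ (N %| x)%Z -> (N %| y - x)%Z -> cc x y = 1.
Proof. by move=> nx yx; rewrite /coordC yx (negbTE (not_eq_opp nx yx)) subr0. Qed.

Lemma coord_ne (x y : int) :
  ~~ (N %| y - x)%Z -> ~~ (N %| y + x)%Z -> cc x y = 0.
Proof. by move=> /negbTE d /negbTE d'; rewrite /coordC d d' subrr. Qed.

Lemma coord_ge0 (x y : int) : ~~ (N %| y + x)%Z -> 0 <= cc x y.
Proof. by move=> /negbTE d; rewrite /coordC d subr0 ler0n. Qed.

Lemma coord_gt0 (x y : int) : 0 < cc x y -> (N %| y - x)%Z.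
Proof.
rewrite /coordC; case: (N %| y - x)%Z => //=.
by rewrite sub0r oppr_gt0 ltNge ler0n.
Qed.

Lemma coordN (x y : int) : cc x (- y) = - cc x y.
Proof.
rewrite /coordC opprB; congr (_%:R - _%:R).
  by rewrite (_ : - y - x = - (y + x)) ?rpredN //; ring.
by rewrite (_ : - y + x = - (y - x)) ?rpredN //; ring.
Qed.

Lemma coordC_sym (x y : int) : cc x y = cc y x.
Proof.
rewrite /coordC [x + y]addrC; congr (_%:R - _).
by rewrite -rpredN opprB.
Qed.

Lemma coord_congr (x y y' : int) : (N %| y' - y)%Z -> cc x y' = cc x y.
Proof.
move=> d; rewrite /coordC.
have -> : (N %| y' - x)%Z = (N %| y - x)%Z by apply/idP/idP => ?; dvd.
by have -> : (N %| y' + x)%Z = (N %| y + x)%Z by apply/idP/idP => ?; dvd.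
Qed.

Lemma coord_sum_gt0 (x g h : int) :
  0 < cc x g + cc x h -> (N %| g - x)%Z \/ (N %| h - x)%Z.
Proof.
move=> gt; have [g0|g0] := ltP 0 (cc x g); first by left; apply: coord_gt0.
by right; apply: coord_gt0; lra.
Qed.

Lemma coord_ne2 (x y : int) :
  ~~ (N %| y - x)%Z -> ~~ (N %| y + x)%Z -> cc x y = 0 /\ cc y x = 0.
Proof. by move=> d d'; rewrite (coordC_sym y) coord_ne. Qed.

(** * Roots in the cone of e_p + e_q and e_v - e_p *)

Section Shared.
Variables (s t : R) (p q v g h : int).
Hypotheses (np : ~~ (N %| p)%Z) (nq : ~~ (N %| q)%Z) (nv : ~~ (N %| v)%Z)
  (ng : ~~ (N %| g)%Z) (nh : ~~ (N %| h)%Z).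
Hypotheses (npq : ~~ (N %| p + q)%Z) (nvp : ~~ (N %| v - p)%Z)
  (ngh : ~~ (N %| g + h)%Z).
Hypotheses (t_gt0 : 0 < t) (le_ts : t <= s).
Hypothesis E : forall x, ~~ (N %| x)%Z ->
  cc x g + cc x h = (s - t) * cc x p + s * cc x q + t * cc x v.

(** Here e_v = -e_q modulo e_N, so e_g + e_h becomes (s - t)(e_p + e_q), and comparing supports
    matches {g, h} with {p, q}. *)
Lemma shared_antiparallel : (N %| v + q)%Z ->
  s - t = 1 /\ ((N %| g - p)%Z /\ (N %| h - q)%Z \/
                (N %| g - q)%Z /\ (N %| h - p)%Z).
Proof.
move=> vq.
have E' x : ~~ (N %| x)%Z -> cc x g + cc x h = (s - t) * (cc x p + cc x q).
  move=> nx; rewrite E //.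
  have -> : cc x v = - cc x q by rewrite -coordN; apply: coord_congr; dvd.
  by ring.
have pq0 : 0 <= cc p q by apply: coord_ge0; rewrite addrC.
have gh0 : 0 <= cc g h by apply: coord_ge0; rewrite addrC.
have pp : cc p p = 1 by apply: coord_eq => //; dvd.
have qq : cc q q = 1 by apply: coord_eq => //; dvd.
have gg : cc g g = 1 by apply: coord_eq => //; dvd.
have hh : cc h h = 1 by apply: coord_eq => //; dvd.
have := E' g ng; rewrite gg => Eg.
have := E' h nh; rewrite hh coordC_sym => Eh.
have := E' p np; rewrite pp => Ep.
have := E' q nq; rewrite qq (coordC_sym q p) => Eq.
have st0 : 0 < s - t.
  rewrite lt_neqAle subr_ge0 le_ts andbT; apply/eqP => st.
  by move: Eg; rewrite -st mul0r; lra.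
have gpq : (N %| p - g)%Z \/ (N %| q - g)%Z.
  by apply: coord_sum_gt0; rewrite -(pmulr_rgt0 _ st0) -Eg; lra.
have hpq : (N %| p - h)%Z \/ (N %| q - h)%Z.
  by apply: coord_sum_gt0; rewrite -(pmulr_rgt0 _ st0) -Eh; lra.
have pgh : (N %| g - p)%Z \/ (N %| h - p)%Z.
  by apply: coord_sum_gt0; rewrite Ep; nra.
have qgh : (N %| g - q)%Z \/ (N %| h - q)%Z.
  by apply: coord_sum_gt0; rewrite Eq; nra.
have match_gh : (N %| g - p)%Z /\ (N %| h - q)%Z \/
                (N %| g - q)%Z /\ (N %| h - p)%Z.
  case: pgh => pgh; case: qgh => qgh; try (by [left|right]).
    by case: hpq => hpq; [right|left]; split; dvd.
  by case: gpq => gpq; [left|right]; split; dvd.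
split=> //.
(* The coordinate of e_p + e_q at p is 2 if q = p modulo N and 1 otherwise; being nonzero, it can be
   cancelled. *)
have E1 : cc p g + cc p h = 1 + cc p q.
  case: match_gh => -[gE hE].
    by rewrite coord_eq // (coord_congr _ hE).
  by rewrite addrC coord_eq // (coord_congr _ gE).
have : (s - t - 1) * (1 + cc p q) = 0 by rewrite mulrBl mul1r -Ep E1 subrr.
move/eqP; rewrite mulf_eq0 => /orP[/eqP|/eqP]; lra.
Qed.

(** The second root is long and e_g + e_h = (s - 2t)e_p + s e_q modulo e_N. As s > 0, one of g, h is
    q modulo N; the other is q or -p, since p would force t = 0. *)
Lemma shared_long : (N %| v + p)%Z -> ~~ (N %| v + q)%Z ->
  t = 1 /\ (s = 1 /\ ((N %| g - q)%Z /\ (N %| h - v)%Z \/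
                      (N %| g - v)%Z /\ (N %| h - q)%Z)
           \/ s = 2 /\ (N %| g - q)%Z /\ (N %| h - q)%Z).
Proof.
move=> vp nvq.
(* [lra] ignores section hypotheses. *)
have t0 := t_gt0; have ts := le_ts.
have nqp : ~~ (N %| p - q)%Z by nz nvq.
have [qp0 pq0] : cc q p = 0 /\ cc p q = 0 by apply: coord_ne2.
have qq : cc q q = 1 by apply: coord_eq => //; dvd.
have pp : cc p p = 1 by apply: coord_eq => //; dvd.
have key (a b : int) : ~~ (N %| b)%Z -> ~~ (N %| a + b)%Z -> (N %| a - q)%Z ->
    (forall x, ~~ (N %| x)%Z ->
       cc x a + cc x b = (s - t) * cc x p + s * cc x q + t * cc x v) ->
    t = 1 /\ (s = 1 /\ (N %| b - v)%Z \/ s = 2 /\ (N %| b - q)%Z).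
  move=> nb nab aq Eab.
  have E' x : ~~ (N %| x)%Z -> cc x a + cc x b = (s - t - t) * cc x p + s * cc x q.
    move=> nx; rewrite Eab //.
    have -> : cc x v = - cc x p by rewrite -coordN; apply: coord_congr; dvd.
    by ring.
  have Eq := E' q nq; have Ep := E' p np; have Eb := E' b nb.
  rewrite !(coord_congr _ aq) in Eq Ep Eb; rewrite pp pq0 in Ep.
  rewrite qq qp0 in Eq.
  have bb : cc b b = 1 by apply: coord_eq => //; dvd.
  have [bq|nbq] := boolP (N %| b - q)%Z.
    move: Eq Ep; rewrite !(coord_congr _ bq) qq pq0 => Eq Ep.
    by split; [lra|right; split => //; lra].
  have nbq' : ~~ (N %| b + q)%Z by nz nab.
  have [qb0 bq0] : cc q b = 0 /\ cc b q = 0 by apply: coord_ne2.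
  rewrite qb0 in Eq; rewrite bb bq0 in Eb.
  have [pb|npb] := boolP (N %| p - b)%Z.
    by move: Eb; rewrite (coord_eq nb pb) => Eb; exfalso; lra.
  have [pb|npb'] := boolP (N %| p + b)%Z; last first.
    by move: Eb; rewrite (coord_ne npb npb') => Eb; exfalso; lra.
  move: Eb; rewrite (_ : cc b p = -1) => [Eb|].
    by split; [lra|left; split; [lra|dvd]].
  by rewrite -[p]opprK coordN coord_eq //; dvd.
have qgh : (N %| g - q)%Z \/ (N %| h - q)%Z.
  apply: coord_sum_gt0; rewrite E // qp0 qq (_ : cc q v = 0); first lra.
  by apply: coord_ne => //; nz npq.
case: qgh => [gq|hq].
  have [-> [[-> hv]|[-> hq]]] := key g h nh ngh gq E; split=> //.
    by left; split => //; left.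
  by right.
have E2 x : ~~ (N %| x)%Z ->
    cc x h + cc x g = (s - t) * cc x p + s * cc x q + t * cc x v.
  by move=> nx; rewrite addrC E.
have nhg : ~~ (N %| h + g)%Z by rewrite addrC.
have [-> [[-> gv]|[-> gq]]] := key h g ng nhg hq E2; split=> //.
  by left; split => //; right.
by right.
Qed.

(** The coordinate at q is positive, so one of g, h is q modulo N; the other one, [b] in [key], has
    to carry e_v. When v = q modulo N, any other [b] would give s + t = 1 and s - t = 1 or -1,
    against 0 < t <= s. *)
Lemma shared_generic : ~~ (N %| v + p)%Z -> ~~ (N %| v + q)%Z ->
  [/\ t = 1, s = 1 & ((N %| g - q)%Z /\ (N %| h - v)%Z \/
                      (N %| g - v)%Z /\ (N %| h - q)%Z)].
Proof.
move=> nvp' nvq.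
have t0 := t_gt0; have ts := le_ts.
have [vp0 pv0] : cc v p = 0 /\ cc p v = 0.
  by apply: coord_ne2; [nz nvp|nz nvp'].
have qq : cc q q = 1 by apply: coord_eq => //; dvd.
have pp : cc p p = 1 by apply: coord_eq => //; dvd.
have vv : cc v v = 1 by apply: coord_eq => //; dvd.
have qp0 : 0 <= cc q p by apply: coord_ge0.
have qv0 : 0 <= cc q v by apply: coord_ge0.
have st_qp : 0 <= (s - t) * cc q p by apply: mulr_ge0 => //; lra.
have t_qv : 0 <= t * cc q v by apply: mulr_ge0 => //; lra.
have key (a b : int) : ~~ (N %| a)%Z -> ~~ (N %| b)%Z -> ~~ (N %| a + b)%Z ->
    (N %| a - q)%Z ->
    (forall x, ~~ (N %| x)%Z ->
       cc x a + cc x b = (s - t) * cc x p + s * cc x q + t * cc x v) ->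
    [/\ t = 1, s = 1 & (N %| b - v)%Z].
  move=> na nb nab aq Eab.
  have Eq := Eab q nq; have Ep := Eab p np; have Eb := Eab b nb.
  have Ev := Eab v nv.
  rewrite !(coord_congr _ aq) in Eq Ep Eb Ev.
  rewrite vp0 vv in Ev; rewrite pp pv0 in Ep; rewrite qq in Eq.
  have bb : cc b b = 1 by apply: coord_eq => //; dvd.
  rewrite bb in Eb.
  have nbq' : ~~ (N %| b + q)%Z by nz nab.
  have [vq|nvq'] := boolP (N %| v - q)%Z.
    have [qp pq] : cc q p = 0 /\ cc p q = 0.
      by apply: coord_ne2; [nz nvp|nz nvp'].
    rewrite (coord_congr _ vq) qq qp in Eq; rewrite pq in Ep.
    have [bq|nbq] := boolP (N %| b - q)%Z.
      move: Eq Ep; rewrite !(coord_congr _ bq) qq pq => Eq Ep.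
      by split; [lra|lra|dvd].
    have [qb bq] : cc q b = 0 /\ cc b q = 0 by apply: coord_ne2.
    rewrite (coord_congr _ vq) bq in Eb; rewrite qb in Eq.
    have [pb|npb] := boolP (N %| p - b)%Z.
      by move: Eb; rewrite (coord_eq nb pb) => Eb; exfalso; lra.
    have [pb|npb'] := boolP (N %| p + b)%Z; last first.
      by move: Eb; rewrite (coord_ne npb npb') => Eb; exfalso; lra.
    move: Eb; rewrite (_ : cc b p = -1) => [Eb|]; first by exfalso; lra.
    by rewrite -[p]opprK coordN coord_eq //; dvd.
  have [vq qv] : cc v q = 0 /\ cc q v = 0.
    by apply: coord_ne2; [nz nvq'|rewrite addrC].
  rewrite vq in Ev.
  have bv : (N %| b - v)%Z by apply: coord_gt0; lra.
  move: Ev Eq; rewrite !(coord_congr _ bv) vv qv => Ev Eq.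
  by split=> //; lra.
have qgh : (N %| g - q)%Z \/ (N %| h - q)%Z.
  by apply: coord_sum_gt0; rewrite E // qq; lra.
case: qgh => [gq|hq].
  by have [-> -> hv] := key g h ng nh ngh gq E; split=> //; left.
have E2 x : ~~ (N %| x)%Z ->
    cc x h + cc x g = (s - t) * cc x p + s * cc x q + t * cc x v.
  by move=> nx; rewrite addrC E.
have nhg : ~~ (N %| h + g)%Z by rewrite addrC.
by have [-> -> gv] := key h g nh ng nhg hq E2; split=> //; right.
Qed.

End Shared.
End Coordinates.

(** * Inversion sets are closed under cones of real pairs *)

Section Closed.
Variables (N : int) (R : realFieldType) (T : int -> int -> Prop).
Hypotheses (N_gt0 : 0 < N) (N_odd : exists k : int, N = k + k + 1).
Hypothesis TI : inversion_set N T.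
Local Notation cc := (@coordC R N).

Lemma int_eq_of_real (a b : int) : a%:~R = b%:~R :> R -> a = b.
Proof. by move/eqP; rewrite eqr_int => /eqP. Qed.

Lemma inv_congr (p q g h : int) : (N %| g - p)%Z \/ (N %| h - p)%Z ->
  g + h = p + q -> T p q -> T g h.
Proof.
move=> [gp|hp] E T1; first exact: (inv_shift TI) T1.
by apply: (inv_sym TI); apply: (inv_shift TI) T1 => //; rewrite addrC.
Qed.

(** The reversal of (p, q) followed by (-p, v) gives (q, v). Unless the roots are opposite modulo
    e_N, (g, h) is, up to translation and symmetry, this composite, or (q, p) followed by a
    translate of (v, q). *)
Lemma cone_shared (s t : R) (p q v g h : int) :
  ~~ (N %| p)%Z -> ~~ (N %| q)%Z -> ~~ (N %| v)%Z ->
  ~~ (N %| g)%Z -> ~~ (N %| h)%Z -> ~~ (N %| p + q)%Z -> ~~ (N %| v - p)%Z ->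
  ~~ (N %| g + h)%Z -> 0 < p + q -> 0 < v - p -> 0 < s -> 0 < t ->
  (forall x, ~~ (N %| x)%Z ->
     cc x g + cc x h = (s - t) * cc x p + s * cc x q + t * cc x v) ->
  (g + h)%:~R = s * (p + q)%:~R + t * (v - p)%:~R ->
  T p q -> T (- p) v -> T g h.
Proof.
(* Exchanging the two roots replaces p by -p. *)
wlog le_ts : s t p q v / t <= s.
  move=> IH np nq nv ng nh npq nvp ngh pq vp s0 t0 E S T1 T2.
  have [|lt] := leP t s.
    by move=> le; apply: (IH s t p q v).
  have le : s <= t by apply: ltW.
  apply: (IH t s (- p) v q) => //; rewrite ?opprK ?[- p + v]addrC ?[q + p]addrC //.
  - by nz np.
  - by move=> x nx; rewrite E // coordN; ring.
  - by rewrite S; ring.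
move=> np nq nv ng nh npq nvp ngh pq vp s0 t0 E S T1 T2.
have Tqv : T q v by apply: (inv_trans TI nq np nv _ vp (inv_sym TI T1) T2); slia.
have [vq|nvq] := boolP (N %| v + q)%Z.
  have [st] := shared_antiparallel N_odd np nq ng nh npq ngh le_ts E vq.
  case=> -[gp hq].
    exact: (cone_antiparallel N_gt0 TI np nq vq gp hq pq vp t0 st S).
  apply: (inv_sym TI).
  apply: (cone_antiparallel N_gt0 TI np nq vq hq gp pq vp t0 st) => //.
  by rewrite addrC.
have sum1 : t = 1 -> s = 1 -> g + h = q + v.
  move=> t1 s1; apply: int_eq_of_real.
  by rewrite S t1 s1 !rmorphD rmorphN /=; ring.
have [vp'|nvp'] := boolP (N %| v + p)%Z.
  have [t1 [[s1 gh]|[s2 [gq hq]]]] :=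
    shared_long N_odd np nq ng nh npq ngh t0 le_ts E vp' nvq.
    apply: (inv_congr _ (sum1 t1 s1) Tqv).
    by case: gh => -[? ?]; [left|right].
  have sum2 : g + h = p + q + (q + v).
    apply: int_eq_of_real.
    by rewrite S t1 s2 !rmorphD rmorphN /=; ring.
  have T3 : T (- p) (q + v + p).
    by apply: (inv_shift TI) (inv_sym TI Tqv); [dvd|slia].
  have : T q (q + v + p).
    apply: (inv_trans TI) (inv_sym TI T1) T3 => //; first by nz nq.
      by slia.
    by slia.
  by apply: inv_congr; [left|slia].
have [t1 s1 gh] :=
  shared_generic N_odd np nq nv ng nh npq nvp ngh t0 le_ts E nvp' nvq.
apply: (inv_congr _ (sum1 t1 s1) Tqv).
by case: gh => -[? ?]; [left|right].
Qed.

(** No index of one root is opposite modulo N to an index of the other, so nothing cancels and each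
    of p, q, u, v is g or h modulo N. *)
Lemma cone_disjoint (s t : R) (p q u v g h : int) :
  ~~ (N %| p)%Z -> ~~ (N %| q)%Z -> ~~ (N %| u)%Z -> ~~ (N %| v)%Z ->
  ~~ (N %| g)%Z -> ~~ (N %| h)%Z ->
  ~~ (N %| p + q)%Z -> ~~ (N %| u + v)%Z -> ~~ (N %| g + h)%Z ->
  ~~ (N %| u + p)%Z -> ~~ (N %| v + p)%Z ->
  ~~ (N %| u + q)%Z -> ~~ (N %| v + q)%Z ->
  0 < p + q -> 0 < u + v -> 0 < s -> 0 < t ->
  (forall x, ~~ (N %| x)%Z ->
     cc x g + cc x h = s * (cc x p + cc x q) + t * (cc x u + cc x v)) ->
  (g + h)%:~R = s * (p + q)%:~R + t * (u + v)%:~R ->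
  T p q -> T u v -> T g h.
Proof.
move=> np nq nu nv ng nh npq nuv ngh nup nvp nuq nvq pq uv s0 t0 E S T1 T2.
have supp x : ~~ (N %| x)%Z -> 0 < cc x p + cc x q \/ 0 < cc x u + cc x v ->
    0 <= cc x p + cc x q -> 0 <= cc x u + cc x v ->
    (N %| g - x)%Z \/ (N %| h - x)%Z.
  move=> nx pos ge1 ge2; apply: (@coord_sum_gt0 N R); rewrite E //.
  case: pos => pos; [apply: ltr_pwDl|apply: ltr_wpDl];
    by rewrite ?mulr_gt0 ?mulr_ge0 // ltW.
have Hp : (N %| g - p)%Z \/ (N %| h - p)%Z.
  have e1 : cc p p = 1 by apply: coord_eq => //; dvd.
  have e2 : 0 <= cc p q by apply: coord_ge0; rewrite addrC.
  have e3 : 0 <= cc p u by apply: coord_ge0.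
  have e4 : 0 <= cc p v by apply: coord_ge0.
  by apply: supp => //; [left; lra|lra|lra].
have Hq : (N %| g - q)%Z \/ (N %| h - q)%Z.
  have e1 : cc q q = 1 by apply: coord_eq => //; dvd.
  have e2 : 0 <= cc q p by apply: coord_ge0.
  have e3 : 0 <= cc q u by apply: coord_ge0.
  have e4 : 0 <= cc q v by apply: coord_ge0.
  by apply: supp => //; [left; lra|lra|lra].
have Hu : (N %| g - u)%Z \/ (N %| h - u)%Z.
  have e1 : cc u u = 1 by apply: coord_eq => //; dvd.
  have e2 : 0 <= cc u v by apply: coord_ge0; rewrite addrC.
  have e3 : 0 <= cc u p by apply: coord_ge0; rewrite addrC.
  have e4 : 0 <= cc u q by apply: coord_ge0; rewrite addrC.
  by apply: supp => //; [right; lra|lra|lra].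
have Hv : (N %| g - v)%Z \/ (N %| h - v)%Z.
  have e1 : cc v v = 1 by apply: coord_eq => //; dvd.
  have e2 : 0 <= cc v u by apply: coord_ge0.
  have e3 : 0 <= cc v p by apply: coord_ge0; rewrite addrC.
  have e4 : 0 <= cc v q by apply: coord_ge0; rewrite addrC.
  by apply: supp => //; [right; lra|lra|lra].
have gg : cc g g = 1 by apply: coord_eq => //; dvd.
have hh : cc h h = 1 by apply: coord_eq => //; dvd.
have Eg := E g ng; have Eh := E h nh; rewrite gg in Eg; rewrite hh in Eh.
have [gh|ngh'] := boolP (N %| g - h)%Z.
  have all_g y : (N %| g - y)%Z \/ (N %| h - y)%Z -> (N %| g - y)%Z.
    by case=> [//|hy]; dvd.
  move: Hp Hq Hu Hv => /all_g gp /all_g gq /all_g gu /all_g gv.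
  have one y : (N %| g - y)%Z -> cc g y = 1.
    by move=> gy; apply: coord_eq => //; dvd.
  rewrite !one // in Eg.
  have up : (N %| u - p)%Z by clear -gu gp; dvd.
  have vq : (N %| v - q)%Z by clear -gv gq; dvd.
  have hq : (N %| h - q)%Z by clear -gh gq; dvd.
  by apply: (cone_parallel N_gt0 TI np nq up vq gp hq pq uv s0 t0 _ S) => //; lra.
have [gh0 hg0] : cc g h = 0 /\ cc h g = 0.
  by apply: coord_ne2; [nz ngh'|rewrite addrC].
have fact y : (N %| g - y)%Z \/ (N %| h - y)%Z ->
    [/\ cc g y = 1, cc h y = 0 & (N %| g - y)%Z] \/
    [/\ cc g y = 0, cc h y = 1 & (N %| h - y)%Z].
  case=> d; [left|right].
    have d' : (N %| y - g)%Z by dvd.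
    by rewrite !(coord_congr _ _ d') gg hg0.
  have d' : (N %| y - h)%Z by dvd.
  by rewrite !(coord_congr _ _ d') hh gh0.
rewrite gh0 in Eg; rewrite hg0 in Eh.
have par (a b c d : int) : (N %| c - a)%Z -> (N %| d - b)%Z -> (N %| g - a)%Z ->
    (N %| h - b)%Z -> ~~ (N %| a)%Z -> ~~ (N %| b)%Z -> s + t = 1 -> a + b = p + q ->
    c + d = u + v -> T a b -> T c d -> T g h.
  move=> ca db ga hb na nb st ab cd.
  by apply: (cone_parallel N_gt0 TI na nb ca db ga hb _ _ s0 t0 st);
    rewrite ?ab ?cd.
have half : s = t -> s + t = 1 -> g + h + (g + h) = (p + q) + (u + v).
  move=> st ss; apply: int_eq_of_real; rewrite [LHS]rmorphD /= S -st.
  rewrite -st in ss; transitivity ((s + s) * ((p + q)%:~R + (u + v)%:~R)); first ring.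
  by rewrite ss mul1r -rmorphD.
have [cpq cuv] : q + p = p + q /\ v + u = u + v by rewrite addrC [v + u]addrC.
have [T1' T2'] := (inv_sym TI T1, inv_sym TI T2).
move: (fact _ Hp) (fact _ Hq) (fact _ Hu) (fact _ Hv) Eg Eh.
(* Both coordinates, at g and at h, are 1, which leaves six of the sixteen assignments: one root is
   twice e_g and the other twice e_h ([half]), or both are e_g + e_h modulo e_N ([par]). *)
case=> -[-> -> dp]; case=> -[-> -> dq]; case=> -[-> -> du]; case=> -[-> -> dv] Eg Eh;
  try (by exfalso; clear -Eg Eh s0 t0; lra).
- have npu : ~~ (N %| p - u)%Z by clear -ngh' dp du; nz ngh'.
  apply: (cone_half N_gt0 TI np nu npu _ _ dp du pq uv (half _ _) T1 T2);
    by [clear -dp dq; dvd|clear -du dv; dvd|lra].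
- by apply: (par p q u v) => //; [clear -dp du; dvd|clear -dq dv; dvd|lra].
- by apply: (par p q v u) => //; [clear -dp dv; dvd|clear -dq du; dvd|lra].
- by apply: (par q p u v) => //; [clear -dq du; dvd|clear -dp dv; dvd|lra].
- by apply: (par q p v u) => //; [clear -dq dv; dvd|clear -dp du; dvd|lra].
- have npu : ~~ (N %| p - u)%Z by clear -ngh' dp du; nz ngh'.
  apply: (inv_sym TI); rewrite [g + h]addrC in half.
  apply: (cone_half N_gt0 TI np nu npu _ _ dp du pq uv (half _ _) T1 T2);
    by [clear -dp dq; dvd|clear -du dv; dvd|lra].
Qed.

Lemma cone_closed (s t : R) (p q u v g h : int) :
  ~~ (N %| p)%Z -> ~~ (N %| q)%Z -> ~~ (N %| u)%Z -> ~~ (N %| v)%Z ->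
  ~~ (N %| g)%Z -> ~~ (N %| h)%Z ->
  ~~ (N %| p + q)%Z -> ~~ (N %| u + v)%Z -> ~~ (N %| g + h)%Z ->
  0 < p + q -> 0 < u + v -> 0 < s -> 0 < t ->
  (forall x, ~~ (N %| x)%Z ->
     cc x g + cc x h = s * (cc x p + cc x q) + t * (cc x u + cc x v)) ->
  (g + h)%:~R = s * (p + q)%:~R + t * (u + v)%:~R ->
  T p q -> T u v -> T g h.
Proof.
move=> np nq nu nv ng nh npq nuv ngh pq uv s0 t0 E S T1 T2.
have shared a b c d : ~~ (N %| a)%Z -> ~~ (N %| b)%Z -> ~~ (N %| d)%Z ->
    a + b = p + q -> c + d = u + v -> (N %| c + a)%Z ->
    (forall x, cc x p + cc x q = cc x a + cc x b) ->
    (forall x, cc x u + cc x v = cc x c + cc x d) ->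
    T a b -> T c d -> T g h.
  move=> na nb nd ab cd ca Eab Ecd T3 T4.
  have sum : d + (c + a) - a = c + d by ring.
  (* The second root is rewritten so that its first index is exactly -a. *)
  apply: (@cone_shared s t a b (d + (c + a))) => //; rewrite ?sum ?ab ?cd //.
  - by nz nd.
  - move=> x nx; rewrite E // Eab Ecd (@coord_congr N R x d (d + (c + a)));
      last by dvd.
    rewrite (_ : cc x c = - cc x a); first by ring.
    by rewrite -coordN; apply: coord_congr; dvd.
  - by apply: (inv_shift TI) T4; [dvd|slia].
have [up|nup] := boolP (N %| u + p)%Z; first exact: (shared p q u v).
have [vp|nvp] := boolP (N %| v + p)%Z.
  apply: (shared p q v u) => //; [exact: addrC|by move=> x; exact: addrC|].
  exact: (inv_sym TI).
have [uq|nuq] := boolP (N %| u + q)%Z.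
  apply: (shared q p u v) => //; [exact: addrC|by move=> x; exact: addrC|].
  exact: (inv_sym TI).
have [vq|nvq] := boolP (N %| v + q)%Z.
  apply: (shared q p v u) => //; try exact: addrC; try exact: (inv_sym TI).
  - by move=> x; exact: addrC.
  - by move=> x; exact: addrC.
exact: (@cone_disjoint s t p q u v).
Qed.

End Closed.

(** * Transitive closure *)

(** Positivity is required in [TransBase] because [pairs_of] can hold with p + q <= 0: on imaginary
    pairs it is decided by p alone. *)
Inductive trans_closure (N : int) (U : int -> int -> Prop) : int -> int -> Prop :=
| TransBase p q of 0 < p + q & U p q : trans_closure N U p q
| TransStep p q r of ~~ (N %| q)%Z &
    trans_closure N U p q & trans_closure N U (- q) r : trans_closure N U p r.

Lemma trans_closure_pos (N : int) (U : int -> int -> Prop) (p q : int) :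
  trans_closure N U p q -> 0 < p + q.
Proof. by elim=> {p q} // p q r _ _ pq _ qr; slia. Qed.

(** Cotransitivity is by induction on the chain: an intermediate point m is the breakpoint q or cuts
    one of the two parts, and a single interval is handled by cotransitivity of [U1] or [U2]. *)
Lemma trans_closure_inversion_set (N : int) (U1 U2 : int -> int -> Prop) :
  inversion_set N U1 -> inversion_set N U2 ->
  inversion_set N (trans_closure N (fun p q => U1 p q \/ U2 p q)).
Proof.
move=> I1 I2; split.
- move=> p q; elim=> {p q} [p q pq U|p q r nq _ T1 _ T2].
    apply: TransBase; first by rewrite addrC.
    by case: U => U; [left; apply: (inv_sym I1)|right; apply: (inv_sym I2)].
  by apply: (@TransStep _ _ r (- q)) => //; rewrite ?rpredN ?opprK.
- move=> p q p' q' d e T; elim: T p' q' d e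
      => {p q} [p q pq U|p q r nq _ T1 _ T2] p' r' d e.
    apply: TransBase; first by slia.
    by case: U => U; [left; apply: (inv_shift I1) U|right; apply: (inv_shift I2) U].
  apply: (@TransStep _ _ p' (q - (p' - p))) => //.
  + by nz nq.
  + by apply: T1 => //; slia.
  + by apply: T2; [dvd|slia].
- by move=> p q r np nq nr pq qr T1 T2; apply: TransStep T1 T2.
- move=> p m r np nm nr pm mr nT1 nT2 T; elim: T m np nm nr pm mr nT1 nT2
      => {p r} [p r pr U|p q r nq T1 IH1 T2 IH2] m np nm nr pm mr nT1 nT2.
    have nb (a b : int) : 0 < a + b ->
        ~ trans_closure N (fun p q => U1 p q \/ U2 p q) a b -> ~ U1 a b /\ ~ U2 a b.
      by move=> ab nT; split=> Uab; apply: nT; apply: TransBase => //; [left|right].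
    have [n1 n2] := nb _ _ pm nT1.
    have [|n3 n4] := nb _ _ _ nT2; first by rewrite addrC.
    by case: U; [apply: (inv_cotrans I1 np nm nr pm mr)
                |apply: (inv_cotrans I2 np nm nr pm mr)].
  have pq := trans_closure_pos T1; have qr := trans_closure_pos T2.
  have [mq|qm|mq] := ltgtP m q.
  + apply: (IH1 m) => //; first by slia.
    by move=> T3; apply: nT2; apply: TransStep T3 T2.
  + apply: (IH2 m) => //; first by nz nq.
      by slia.
    by move=> T3; apply: nT1; apply: TransStep T1 T3.
  + by apply: nT1; rewrite mq.
Qed.

Lemma trans_closure_min (N : int) (U V : int -> int -> Prop) :
  transitive_pairs N V ->
  (forall p q, U p q -> ~~ (N %| p)%Z /\ ~~ (N %| q)%Z) ->
  (forall p q, 0 < p + q -> U p q -> V p q) ->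
  forall p q, trans_closure N U p q -> V p q.
Proof.
move=> Vt Unz UV p q T.
suff: [/\ ~~ (N %| p)%Z, ~~ (N %| q)%Z & V p q] by case.
elim: T => {p q} [p q pq U1|p q r nq T1 [np _ V1] T2 [_ nr V2]].
  by have [? ?] := Unz _ _ U1; split=> //; apply: UV.
split=> //; apply: (Vt _ q) => //.
  exact: trans_closure_pos T1.
by rewrite addrC; apply: trans_closure_pos T2.
Qed.

(** * Roots and biclosed sets *)

Section Roots.
Variables (R : realType) (n : nat).
Local Notation N := (perC n).
Local Notation e := (etilde R n).

Lemma perC_gt0 : 0 < N. Proof. by []. Qed.

Lemma perC_odd : exists k : int, N = k + k + 1.
Proof. by exists n%:Z; rewrite /perC; lia. Qed.

Definition root_pair (p q : int) : Prop :=
  [/\ ~~ (N %| p)%Z, ~~ (N %| q)%Z, ~~ (N %| p + q)%Z & 0 < p + q].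

Lemma posrootP (v : spaceC R n) :
  posrootC R n v <-> exists p q, root_pair p q /\ v = e p + e q.
Proof.
split=> [[i [j [ni nj nij ij ->]]]|[p [q [[np nq npq pq] ->]]]].
  rewrite !eqz_mod_dvd !subr0 in ni nj nij.
  exists j, (- i); rewrite etilde_opp; split=> //; split => //; last by lia.
  - by rewrite rpredN.
  - by rewrite -rpredN opprB.
exists (- q), p; rewrite !eqz_mod_dvd !subr0 etilde_opp opprK.
by split; rewrite ?rpredN //; [rewrite -rpredN opprB opprK|lia].
Qed.

Lemma root_pair_posroot (p q : int) : root_pair p q -> posrootC R n (e p + e q).
Proof. by move=> pq; apply/posrootP; exists p, q. Qed.

Lemma etilde_mulN (i k : int) : e (i + k * N) = e i + k%:~R *: e N.
Proof.
elim/int_ind: k => [|k IH|k IH].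
- by rewrite mul0r scale0r !addr0.
- have kS : k.+1%:Z = k%:Z + 1 by lia.
  have -> : i + k.+1%:Z * N = (i + k%:Z * N) + N by rewrite kS; ring.
  by rewrite etilde_shift IH kS rmorphD scalerDl scale1r addrA.
- have kS : - k.+1%:Z = - k%:Z - 1 by lia.
  apply: (addIr (e N)); rewrite -etilde_shift.
  have -> : i + - k.+1%:Z * N + N = i + - k%:Z * N by rewrite kS; ring.
  by rewrite IH kS rmorphB scalerBl scale1r addrA addrNK.
Qed.

Lemma root_congr (p q p' q' : int) : (N %| p' - p)%Z -> p' + q' = p + q ->
  e p' + e q' = e p + e q.
Proof.
case/dvdzE => k Ek E.
have -> : p' = p + k * N by lia.
have -> : q' = q + (- k) * N by lia.
by rewrite !etilde_mulN rmorphN scaleNr /= addrACA subrr addr0.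
Qed.

(** [coordC], as a function of its second argument, satisfies the two defining relations, so the
    universal property makes it a linear form. *)
Lemma etilde_coord (x : int) : ~~ (N %| x)%Z ->
  exists L : {linear spaceC R n -> R^o}, forall i, L (e i) = coordC R N x i.
Proof.
move=> nx; have [|i|L [HL _]] := @etilde_universal R n R^o (coordC R N x).
- move=> i; rewrite (@coord_ne N R x N); last 2 first.
  + by have dN := dvdzz N; nz nx.
  + by have dN := dvdzz N; nz nx.
  by rewrite addr0; apply: coord_congr; have dN := dvdzz N; dvd.
- exact: coordN.
- by exists L.
Qed.

Lemma etilde_height :
  exists L : {linear spaceC R n -> R^o}, forall i, L (e i) = i%:~R.
Proof.
have [|i|L [HL _]] := @etilde_universal R n R^o (fun i => i%:~R).
- by move=> i; rewrite rmorphD.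
- by rewrite rmorphN.
- by exists L.
Qed.

Lemma cone_coord (s t : R) (p q u v g h : int) :
  e g + e h = s *: (e p + e q) + t *: (e u + e v) ->
  (forall x, ~~ (N %| x)%Z -> coordC R N x g + coordC R N x h =
     s * (coordC R N x p + coordC R N x q) + t * (coordC R N x u + coordC R N x v)) /\
  (g + h)%:~R = s * (p + q)%:~R + t * (u + v)%:~R.
Proof.
move=> E.
have EL (L : {linear spaceC R n -> R^o}) : L (e g) + L (e h) =
    s * (L (e p) + L (e q)) + t * (L (e u) + L (e v)).
  by rewrite -(linearD L) E (linearD L) !linearZZ !(linearD L).
split=> [x /etilde_coord[L HL]|]; first by rewrite -!HL EL.
by have [L HL] := etilde_height; rewrite !rmorphD /= -!HL EL.
Qed.

(** * Sets of roots stable under cones *)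

Definition cone_stable (X : set (spaceC R n)) : Prop :=
  forall a b g, posrootC R n a -> posrootC R n b -> posrootC R n g ->
    in_open_cone a b g -> X a -> X b -> X g.

Section Stable.
Variable X : set (spaceC R n).
Hypothesis SX : cone_stable X.

Lemma stable_add (p q r : int) : root_pair p q -> root_pair (- q) r ->
  ~~ (N %| p + r)%Z -> X (e p + e q) -> X (e (- q) + e r) -> X (e p + e r).
Proof.
move=> pq qr npr Xpq Xqr; have [np nq npq pq0] := pq; have [nq' nr nqr qr0] := qr.
have pr : root_pair p r by split=> //; slia.
apply: (SX (root_pair_posroot pq) (root_pair_posroot qr)
  (root_pair_posroot pr) _ Xpq Xqr).
exists 1, 1; split; rewrite ?ltr01 // etilde_opp.
by move: (e p) (e q) (e r) => a b c; apply/rowP => i; rewrite !mxE; ring.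
Qed.

(** With r = cN - p the two roots sum to c e_N. For k = jN the target is the first root plus j e_N,
    that is, plus j/c times this sum. *)
Lemma stable_dihedral (p m r k : int) : root_pair p m -> (N %| r + p)%Z ->
  0 < r - m -> (N %| k)%Z -> 0 <= k ->
  X (e p + e m) -> X (e (- m) + e r) -> X (e p + e (m + k)).
Proof.
move=> pm rp rm dk k0 Xpm Xrm; have [np nm npm pm0] := pm.
have [->|nk0] := eqVneq k 0; first by rewrite addr0.
have mr : root_pair (- m) r by split; [nz nm|nz np|nz npm|slia].
have pmk : root_pair p (m + k) by split; [|nz nm|nz npm|slia].
apply: (SX (root_pair_posroot pm) (root_pair_posroot mr)
  (root_pair_posroot pmk) _ Xpm Xrm).
have [c Ec] := dvdzE _ _ rp; have [j Ej] := dvdzE _ _ dk.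
have N0 := perC_gt0.
have c0 : 0 < c :> int by clear -rm pm0 Ec N0; nia.
have j0 : 0 < j :> int by clear -k0 nk0 Ej N0; nia.
have c0' : 0 < c%:~R :> R by rewrite ltr0z.
have j0' : 0 < j%:~R :> R by rewrite ltr0z.
have t0 : 0 < j%:~R / c%:~R :> R by rewrite divr_gt0.
exists (1 + j%:~R / c%:~R), (j%:~R / c%:~R); split=> //; first by rewrite addr_gt0.
have -> : r = - p + c * N by rewrite -Ec; ring.
rewrite Ej !etilde_mulN !etilde_opp; move: (e p) (e m) (e N) => a b d.
have cn0 : c%:~R != 0 :> R by rewrite gt_eqF.
by apply/rowP => i; rewrite !mxE; field.
Qed.

Lemma stable_between (p m k K : int) : root_pair p m -> (N %| k)%Z -> (N %| K)%Z ->
  0 <= k <= K -> X (e p + e m) -> X (e p + e (m + K)) -> X (e p + e (m + k)).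
Proof.
move=> pm dk dK /andP[k0 kK] X1 X2; have [np nm npm pm0] := pm.
have [->|nk0] := eqVneq k 0; first by rewrite addr0.
have [->|nkK] := eqVneq k K; first by [].
have pmk : root_pair p (m + k) by split; [|nz nm|nz npm|slia].
have pmK : root_pair p (m + K) by split; [|nz nm|nz npm|slia].
apply: (SX (root_pair_posroot pm) (root_pair_posroot pmK)
  (root_pair_posroot pmk) _ X1 X2).
have [c Ec] := dvdzE _ _ dK; have [j Ej] := dvdzE _ _ dk.
have N0 := perC_gt0.
have j0 : 0 < j :> int by clear -k0 nk0 Ej N0; nia.
have jc : j < c :> int by clear -kK nkK Ej Ec N0; nia.
have j0' : 0 < j%:~R :> R by rewrite ltr0z.
have jc' : j%:~R < c%:~R :> R by rewrite ltr_int.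
have c0' : 0 < c%:~R :> R by apply: lt_trans jc'.
exists (1 - j%:~R / c%:~R), (j%:~R / c%:~R); split=> //.
- by rewrite subr_gt0 ltr_pdivrMr // mul1r.
- by rewrite divr_gt0.
rewrite Ej Ec !etilde_mulN; move: (e p) (e m) (e N) => a b d.
have cn0 : c%:~R != 0 :> R by rewrite gt_eqF.
by apply/rowP => i; rewrite !mxE; field.
Qed.

End Stable.
End Roots.

(** * The inversion set of a biclosed set *)

Section PairsOf.
Variables (R : realType) (n : nat).
Local Notation N := (perC n).
Local Notation e := (etilde R n).
Local Notation root_pair := (root_pair n).

(** The length r + p is left free because, by [imaginary_indep], an inversion set contains all
    positive imaginary pairs at p or none. *)
Definition imaginary (B : set (spaceC R n)) (p : int) : Prop :=
  exists m r, [/\ root_pair p m, (N %| r + p)%Z, 0 < r - m,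
    B (e p + e m) & B (e (- m) + e r)].

(* A biclosed set says nothing about the pairs with N | p + q; they are added
   only when forced, so that [pairs_of] is monotone. *)
Definition pairs_of (B : set (spaceC R n)) (p q : int) : Prop :=
  [/\ ~~ (N %| p)%Z, ~~ (N %| q)%Z &
    if (N %| p + q)%Z then imaginary B p else B (e p + e q)].

Lemma pairs_of_mono (B B' : set (spaceC R n)) (p q : int) :
  B `<=` B' -> pairs_of B p q -> pairs_of B' p q.
Proof.
move=> BB' [np nq H]; split=> //; case: ifP H => _; last exact: BB'.
by case=> m [r [? ? ? ? ?]]; exists m, r; split=> //; apply: BB'.
Qed.

Variable B : set (spaceC R n).

(** Reversing the chain -p < m < r gives -r < -m < p, and translating by r - q makes it start at
    -q. *)
Lemma imaginary_sym (p q : int) : (N %| p + q)%Z -> imaginary B p -> imaginary B q.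
Proof.
move=> pq [m [r [[np nm npm pm0] rp rm X1 X2]]].
exists (- m + (r - q)), (p + (r - q)); split.
- by split; [nz np|nz nm|nz npm|slia].
- by dvd.
- by slia.
- by rewrite (@root_congr R n r (- m)); [rewrite addrC|dvd|slia].
- by rewrite (@root_congr R n m p); [rewrite addrC|dvd|slia].
Qed.

Lemma imaginary_shift (p p' : int) : (N %| p' - p)%Z -> imaginary B p -> imaginary B p'.
Proof.
move=> pp' [m [r [[np nm npm pm0] rp rm X1 X2]]].
exists (m - (p' - p)), (r - (p' - p)); split.
- by split; [nz np|nz nm|nz npm|slia].
- by dvd.
- by slia.
- by rewrite (@root_congr R n p m) //; slia.
- by rewrite (@root_congr R n (- m) r) //; [dvd|slia].
Qed.

Lemma pairs_of_sym (p q : int) : pairs_of B p q -> pairs_of B q p.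
Proof.
move=> [np nq H]; split=> //; rewrite [q + p]addrC.
by case: ifP H => [pq|_]; [apply: imaginary_sym|rewrite addrC].
Qed.

Lemma pairs_of_shift : shift_invariant N (pairs_of B).
Proof.
move=> p q p' q' d E [np nq H]; split; [nz np|nz nq|rewrite E].
by case: ifP H => [_|_]; [apply: imaginary_shift|rewrite (root_congr R d E)].
Qed.

Lemma pairs_of_real (p q : int) : root_pair p q -> (pairs_of B p q <-> B (e p + e q)).
Proof.
move=> [np nq npq pq]; rewrite /pairs_of (negbTE npq).
by split=> [[]|].
Qed.

Hypotheses (SB : cone_stable B) (SC : cone_stable (~` B)).

(** If m = m' modulo N, [stable_dihedral] applies. Otherwise the chain from -p through m' to r,
    followed by the translate of (p, a) by P = r + p, composes from the right through real roots and
    lengthens (p, a) by P. *)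
Lemma stable_imaginary (p m k : int) : imaginary B p -> root_pair p m ->
  (N %| k)%Z -> 0 <= k -> B (e p + e m) -> B (e p + e (m + k)).
Proof.
move=> [m' [r [pm' rp rm X1 X2]]] pm dk k0 Xm.
have [np nm npm pm0] := pm; have [_ nm' npm' pm'0] := pm'.
have [mm'|nmm'] := boolP (N %| m - m')%Z.
  apply: (@stable_dihedral R n B SB p m (r + (m - m')) k) => //; try dvd.
  - by slia.
  - by rewrite (@root_congr R n (- m') r) //; [dvd|slia].
pose P := r + p.
have P0 : 0 < P by rewrite /P; slia.
have dP : (N %| P)%Z by [].
have step a : root_pair p a -> ~~ (N %| a - m')%Z ->
    B (e p + e a) -> B (e p + e (a + P)).
  move=> [_ na npa pa0] nam Xa.
  have Y1 : B (e (- r) + e (a + P)).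
    by rewrite (@root_congr R n p a) //; rewrite /P; [dvd|slia].
  have Y2 : B (e (- m') + e (a + P)).
    apply: (@stable_add R n B SB _ r) => //.
    - by split; [nz nm'|nz np|nz npm'|slia].
    - by rewrite /P; split; [nz np|nz na|nz npa|slia].
    - by nz nam.
  apply: (@stable_add R n B SB p m') => //.
  - by rewrite /P; split; [nz nm'|nz na|nz nam|slia].
  - by nz npa.
have iter (i : nat) : B (e p + e (m + P *+ i)).
  elim: i => [|i IH]; first by rewrite mulr0n addr0.
  have dPi : (N %| P *+ i)%Z by rewrite -mulr_natr dvdz_mulr.
  have Pi0 : 0 <= P *+ i by rewrite mulrn_wge0 // ltW.
  rewrite mulrSr addrA; apply: step => //; last by nz nmm'.
  by split; [|nz nm|nz npm|slia].
(* As P >= 1, |k| iterations go at least as far as k. *)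
apply: (@stable_between R n B SB p m k (P *+ `|k|%N)) => //.
- by rewrite -mulr_natr dvdz_mulr.
- rewrite k0 /= -mulr_natr; clear -P0 k0; nia.
Qed.

(** Two imaginary pairs are easy since [imaginary] looks at p only; two real ones compose by
    [stable_add] or by definition of [imaginary]. In the mixed case [half], a translate of the real
    pair starts at -p and [stable_imaginary] lengthens it by p + q; the other mixed case is its
    reversal. *)
Lemma pairs_of_trans : transitive_pairs N (pairs_of B).
Proof.
have half (p q r : int) : ~~ (N %| p)%Z -> ~~ (N %| q)%Z -> ~~ (N %| r)%Z ->
    0 < p + q -> 0 < r - q -> (N %| p + q)%Z -> ~~ (N %| - q + r)%Z ->
    pairs_of B p q -> pairs_of B (- q) r -> pairs_of B p r.
  move=> np nq nr pq0 qr0 pq nqr [_ _]; rewrite pq => Ip [_ _].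
  rewrite (negbTE nqr) => X.
  have npr : ~~ (N %| p + r)%Z by nz nqr.
  split=> //; rewrite (negbTE npr).
  have -> : r = r - (p + q) + (p + q) by ring.
  apply: stable_imaginary => //; last 2 first.
  - exact: ltW.
  - by rewrite (@root_congr R n (- q) r) //; [dvd|ring].
  by split; [|nz nr|nz npr|slia].
move=> p q r np nq nr pq0 qr0 T1 T2.
have [pq|npq] := boolP (N %| p + q)%Z; have [qr|nqr] := boolP (N %| - q + r)%Z.
- have pr : (N %| p + r)%Z by dvd.
  by split=> //; case: T1 => _ _; rewrite pq pr.
- exact: (half p q r).
- apply: pairs_of_sym; apply: (half r (- q) p) => //; rewrite ?opprK //.
  + by rewrite rpredN.
  + by rewrite addrC.
  + by nz npq.
  + exact: pairs_of_sym.
  + exact: pairs_of_sym.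
case: T1 => _ _; rewrite (negbTE npq) => X1.
case: T2 => _ _; rewrite (negbTE nqr) => X2.
have rpq : root_pair p q by [].
have rqr : root_pair (- q) r by split=> //; [rewrite rpredN|rewrite addrC].
split=> //; case: ifPn => [pr|npr]; last exact: (stable_add SB rpq rqr).
by exists q, r; split=> //; rewrite addrC.
Qed.

(** Let -p < m < r' be a chain in [B]. If q = m modulo N, moving the smaller of q, m up to the
    larger by [stable_dihedral] gives a contradiction. Otherwise take -p < q < m + k < r' + k with k
    large: (p, m + k) and the last interval are in [B], while (p, q) and (-q, r' + k) are not, so
    the interval from q to m + k can be neither in [B] nor outside. *)
Lemma not_imaginary (p q r : int) : root_pair p q -> (N %| r + p)%Z -> 0 < r - q ->
  ~ B (e p + e q) -> ~ B (e (- q) + e r) -> ~ imaginary B p.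
Proof.
move=> rpq rp rq0 X1 X2 [m [r' [rpm rp' rm0 Y1 Y2]]].
have [np nq npq pq0] := rpq; have [_ nm npm pm0] := rpm.
have [mq|nmq] := boolP (N %| q - m)%Z.
  have [c0|c0] := leP 0 (q - m).
    apply: X1; rewrite (_ : q = m + (q - m)); last by ring.
    exact: (stable_dihedral SB rpm rp').
  have := @stable_dihedral R n _ SC p q r (m - q) rpq rp rq0 _ _ X1 X2.
  by rewrite (_ : q + (m - q) = m); [apply => //; [dvd|slia]|ring].
have nr : ~~ (N %| r)%Z by nz np.
have nr' : ~~ (N %| r')%Z by nz np.
pose k := N * (`|q - m| + `|r - r'| + 1).
have dk : (N %| k)%Z by rewrite /k dvdz_mulr.
have [k0 km kr] : [/\ 0 <= k, q - m < k & r - r' <= k].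
  have N1 := perC_gt0 n; rewrite /k; clear -N1.
  by split; nia.
have Ym : B (e p + e (m + k)) by apply: (stable_dihedral SB rpm rp').
have Xr : ~ B (e (- q) + e (r' + k)).
  (* The second root is the translate of (p, q) by r + p, so both roots lie outside [B]. *)
  have := @stable_dihedral R n _ SC (- q) r (p + q + r) (r' + k - r).
  rewrite (_ : r + (r' + k - r) = r' + k); last by ring.
  apply => //; try dvd.
  - by split; [nz nq| |nz npq|slia].
  - by slia.
  - by slia.
  - by rewrite /= (@root_congr R n p q) //; [dvd|ring].
have rqm : root_pair (- q) (m + k) by split; [nz nq|nz nm|nz nmq|slia].
have rmr : root_pair (- (m + k)) (r' + k) by split; [nz nm|nz nr'|nz npm|slia].
have Z1 : ~ B (e (- q) + e (m + k)).
  move=> Z; apply: Xr; apply: (stable_add SB rqm rmr) => //.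
    by nz npq.
  by rewrite (@root_congr R n (- m) r') //; [dvd|ring].
have Z2 : ~ B (e p + e (m + k)).
  by apply: (stable_add SC rpq rqm) => //; nz npm.
exact: Z2.
Qed.

(** In the mixed case [half], suppose (p, r) is in [B]. Then the interval from r to k - p is not, as
    [imaginary B p] fails. Translated by -(p + q), it follows the pair (p, r - (p + q)), a translate
    of (-q, r), and [stable_dihedral] for the complement excludes (p, r). *)
Lemma pairs_of_cotrans : transitive_pairs N (fun p q => ~ pairs_of B p q).
Proof.
have half (p q r : int) : ~~ (N %| p)%Z -> ~~ (N %| q)%Z -> ~~ (N %| r)%Z ->
    0 < p + q -> 0 < r - q -> (N %| p + q)%Z -> ~~ (N %| - q + r)%Z ->
    ~ pairs_of B p q -> ~ pairs_of B (- q) r -> ~ pairs_of B p r.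
  move=> np nq nr pq0 qr0 pq nqr T1 T2 T3.
  have npr : ~~ (N %| p + r)%Z by nz nqr.
  have nI : ~ imaginary B p by move=> Ip; apply: T1; split; rewrite // pq.
  have Xqr : ~ B (e (- q) + e r).
    move=> X; apply: T2; split=> //; first by rewrite rpredN.
    by rewrite (negbTE nqr).
  have Xpr : B (e p + e r) by case: T3; rewrite (negbTE npr).
  pose k := N * (`|p| + `|r| + 1).
  have dk : (N %| k)%Z by rewrite /k dvdz_mulr.
  have k0 : 0 < k - p - r.
    have N1 := perC_gt0 n; rewrite /k; clear -N1; nia.
  have nX : ~ B (e (- r) + e (k - p)).
    move=> X; apply: nI; exists r, (k - p); split=> //; first by split=> //; slia.
    by dvd.
  have := @stable_dihedral R n _ SC p (r - (p + q)) (k - p - (p + q)) (p + q).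
  rewrite subrK => H; apply: H Xpr => //; try dvd.
  - by split; [|nz nr|nz npr|slia].
  - by slia.
  - exact: ltW.
  - by rewrite /= (@root_congr R n (- q) r) //; [dvd|ring].
  - by rewrite /= (@root_congr R n (- r) (k - p)) //; [dvd|ring].
move=> p q r np nq nr pq0 qr0 T1 T2.
have [pq|npq] := boolP (N %| p + q)%Z; have [qr|nqr] := boolP (N %| - q + r)%Z.
- have pr : (N %| p + r)%Z by dvd.
  by move=> [_ _]; rewrite pr => Ip; apply: T1; split; rewrite // pq.
- exact: (half p q r).
- move=> /pairs_of_sym; apply: (half r (- q) p) => //; rewrite ?opprK //.
  + by rewrite rpredN.
  + by rewrite addrC.
  + by nz npq.
  + by move=> /pairs_of_sym.
  + by move=> /pairs_of_sym.
have rpq : root_pair p q by [].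
have rqr : root_pair (- q) r by split=> //; [rewrite rpredN|rewrite addrC].
have X1 : ~ B (e p + e q) by move/(pairs_of_real rpq).
have X2 : ~ B (e (- q) + e r) by move/(pairs_of_real rqr).
move=> [_ _]; case: ifPn => [pr|npr].
  by apply: (not_imaginary rpq _ qr0 X1 X2); rewrite addrC.
exact: (stable_add SC rpq rqr).
Qed.

Lemma pairs_of_inversion_set : inversion_set N (pairs_of B).
Proof.
split; [exact: pairs_of_sym|exact: pairs_of_shift|exact: pairs_of_trans|].
exact: pairs_of_cotrans.
Qed.

End PairsOf.

(** * Back to biclosed sets: joins and meets *)

Section Lattice.
Variables (R : realType) (n : nat).
Local Notation N := (perC n).
Local Notation e := (etilde R n).

Definition roots_of (T : int -> int -> Prop) : set (spaceC R n) :=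
  [set v | exists p q, [/\ root_pair n p q, T p q & v = e p + e q]].

Lemma cone_inversion_set (T : int -> int -> Prop) (s t : R) (p q u v g h : int) :
  inversion_set N T -> root_pair n p q -> root_pair n u v -> root_pair n g h ->
  0 < s -> 0 < t -> e g + e h = s *: (e p + e q) + t *: (e u + e v) ->
  T p q -> T u v -> T g h.
Proof.
move=> TI [np nq npq pq] [nu nv nuv uv] [ng nh ngh gh] s0 t0 /cone_coord[E S].
exact: (cone_closed (perC_gt0 n) (perC_odd n) TI np nq nu nv ng nh npq nuv ngh
  pq uv s0 t0 E S).
Qed.

(** Several pairs can represent one root; that [T] does not distinguish them follows from closure
    under cones, writing the root as the sum of its two halves. *)
Lemma roots_of_mem (T : int -> int -> Prop) (p q : int) :
  inversion_set N T -> root_pair n p q -> roots_of T (e p + e q) -> T p q.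
Proof.
move=> TI rpq [u [v [ruv Tuv E]]].
have h0 : 0 < 2^-1 :> R by rewrite invr_gt0.
apply: (cone_inversion_set TI ruv ruv rpq h0 h0 _ Tuv Tuv).
by rewrite E -scalerDl (_ : 2^-1 + 2^-1 = 1 :> R) ?scale1r //; lra.
Qed.

Lemma roots_of_biclosed (T : int -> int -> Prop) :
  inversion_set N T -> biclosed (roots_of T).
Proof.
move=> TI; split=> [v [p [q [rpq _ ->]]]|a b g]; first exact: root_pair_posroot.
move=> /posrootP[p [q [rpq ->]]] /posrootP[u [v [ruv ->]]].
move=> /posrootP[k [h [rkh ->]]].
move=> [s [t [s0 t0 E]]]; split.
  move=> /(roots_of_mem TI rpq) T1 /(roots_of_mem TI ruv) T2.
  exists k, h; split=> //.
  exact: (cone_inversion_set TI rpq ruv rkh s0 t0 E).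
move=> nT1 nT2 /(roots_of_mem TI rkh).
apply: (cone_inversion_set (inversion_setC TI) rpq ruv rkh s0 t0 E) => T1.
  by apply: nT1; exists p, q.
by apply: nT2; exists u, v.
Qed.

Lemma biclosed_cone_stable (B : set (spaceC R n)) :
  biclosed B -> cone_stable B /\ cone_stable (~` B).
Proof.
by move=> [_ H]; split=> a b g pa pb pg c; have [] := H a b g pa pb pg c.
Qed.

Lemma biclosed_inversion_set (B : set (spaceC R n)) :
  biclosed B -> inversion_set N (pairs_of B).
Proof. by move=> /biclosed_cone_stable[]; apply: pairs_of_inversion_set. Qed.

Lemma biclosedC (B : set (spaceC R n)) :
  biclosed B -> biclosed (posrootC R n `\` B).
Proof.
move=> [_ H]; split=> [v [] //|a b g pa pb pg c]; have [H1 H2] := H a b g pa pb pg c.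
split=> [[_ nA] [_ nB]|nA nB [_ ng]]; first by split=> //; apply: H2.
by apply: ng; apply: H1; apply: contrapT => nX; [apply: nA|apply: nB].
Qed.

Lemma biclosed_join (A B : set (spaceC R n)) : biclosed A -> biclosed B ->
  exists C, [/\ biclosed C, A `<=` C, B `<=` C &
    forall D, biclosed D -> A `<=` D -> B `<=` D -> C `<=` D].
Proof.
move=> bA bB; pose U p q := pairs_of A p q \/ pairs_of B p q.
exists (roots_of (trans_closure N U)); split.
- apply: roots_of_biclosed; apply: trans_closure_inversion_set;
    exact: biclosed_inversion_set.
- move=> v Av; have [p [q [rpq E]]] := (posrootP v).1 (bA.1 v Av).
  exists p, q; split=> //; apply: TransBase; first by case: rpq.
  by left; apply/(pairs_of_real _ rpq); rewrite -E.
- move=> v Bv; have [p [q [rpq E]]] := (posrootP v).1 (bB.1 v Bv).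
  exists p, q; split=> //; apply: TransBase; first by case: rpq.
  by right; apply/(pairs_of_real _ rpq); rewrite -E.
move=> D bD AD BD v [p [q [rpq T ->]]]; apply/(pairs_of_real _ rpq).
apply: (trans_closure_min (inv_trans (biclosed_inversion_set bD)) _ _ T).
  by move=> a b [[]|[]].
by move=> a b _ [|]; apply: pairs_of_mono.
Qed.

End Lattice.

Theorem theorem5p11 (R : realType) (n : nat) (hn : (1 <= n)%N) :
  is_lattice (bic R n).
Proof.
pose mk C (bC : biclosed C) : bic R n := exist _ C (asboolT bC).
have bic_biclosed (x : bic R n) : biclosed (val x) by case: x => B /= /asboolP.
move=> x y; split.
  have [C [bC xC yC Cmin]] := biclosed_join (bic_biclosed x) (bic_biclosed y).
  exists (mk C bC); split.
    by move=> z [->|->]; rewrite bic_leE.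
  move=> z zub; rewrite bic_leE; apply: Cmin; first exact: bic_biclosed.
    by rewrite -bic_leE; apply: zub; left.
  by rewrite -bic_leE; apply: zub; right.
have [C [bC xC yC Cmin]] :=
  biclosed_join (biclosedC (bic_biclosed x)) (biclosedC (bic_biclosed y)).
exists (mk _ (biclosedC bC)); split.
  move=> z zxy; rewrite bic_leE => v [rv nCv]; apply: contrapT => nzv; apply: nCv.
  by case: zxy => zE; [apply: xC|apply: yC]; split=> //; rewrite -zE.
move=> z zlb; rewrite bic_leE => v zv; split; first exact: (bic_biclosed z).1.
have zx : val z `<=` val x by rewrite -bic_leE; apply: zlb; left.
have zy : val z `<=` val y by rewrite -bic_leE; apply: zlb; right.
have Cz : C `<=` posrootC R n `\` val z.
  by apply: Cmin; [exact: biclosedC|exact: setDS|exact: setDS].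
by move=> /Cz[].
Qed.
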